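(* Let $n\ge2$. A matrix $M\in\mathbb{C}^{n\times n}$ is transverse if and only if $$\det\bigl(I_n+\mathrm{D}(\alpha)M\mathrm{D}(\alpha)\bigr)\neq0$$ for every $\alpha\in\mathcal{I}(M)$. Equivalently, $M$ is transverse if and only if $-1\notin\sigma(\mathrm{D}(\alpha)M\mathrm{D}(\alpha))$ for every $\alpha\in\mathcal{I}(M)$.
   Context: For $M\in\mathbb{C}^{n\times n}$, let $f_M=(f_{M,1},\dots,f_{M,n}):\mathbb{C}^n\to\mathbb{C}^n$ with $f_{M,k}(x)=x_k(Mx)_k-1$. The set of inverse eigenvectors of $M$ is the zero set $\mathcal{I}(M)=\{\alpha\in\mathbb{C}^n: f_M(\alpha)=0\}$. $M$ is called transverse if $0$ is a regular value of $f_M$, i.e. the (holomorphic) Jacobian determinant of $f_M$ is nonzero at every $\alpha\in\mathcal{I}(M)$. $\mathrm{D}(x)$ denotes the diagonal matrix with diagonal $x$, and $\sigma(A)$ is the spectrum of $A$. *)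

(* Defs.v *)
(* Points of C^n are row vectors, since the library Jacobian is defined on those. *)
From mathcomp Require Import all_boot all_order all_algebra.
From mathcomp Require Import boolp classical_sets reals topology normedtype derive.
From mathcomp Require Import complex.

Set Implicit Arguments.
Unset Strict Implicit.
Unset Printing Implicit Defensive.

Import Order.TTheory GRing.Theory Num.Theory.
Import numFieldNormedType.Exports.

Local Open Scope classical_set_scope.
Local Open Scope ring_scope.

(* 'J f a is the matrix of the K-linear differential of f at a, so for K = R[i]
   it is the holomorphic Jacobian matrix. It acts on row vectors from the right,
   i.e. it is the transpose of the usual one, which has the same determinant.
   Meant for f differentiable on the fibre over y ('d is arbitrary elsewhere). *)
Definition regular_value (K : numFieldType) (n : nat)
    (f : 'rV[K]_n -> 'rV[K]_n) (y : 'rV[K]_n) : Prop :=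
  forall a, f a = y -> \det ('J f a) != 0.

Definition inv_eigen_map (K : numFieldType) (n : nat) (M : 'M[K]_n)
    (x : 'rV[K]_n) : 'rV[K]_n :=
  \row_k (x 0 k * (M *m x^T) k 0 - 1).

Definition inv_eigenvectors (K : numFieldType) (n : nat) (M : 'M[K]_n) :
    set 'rV[K]_n :=
  [set a | inv_eigen_map M a = 0].

Definition transverse (K : numFieldType) (n : nat) (M : 'M[K]_n) : Prop :=
  regular_value (inv_eigen_map M) 0.

Definition spectrum (K : fieldType) (n : nat) (A : 'M[K]_n) : set K :=
  [set a | eigenvalue A a].

(* Main.v *)
Require Import Defs.
From mathcomp Require Import all_boot all_order all_algebra.
From mathcomp Require Import boolp classical_sets reals topology normedtype derive.
From mathcomp Require Import complex.
From mathcomp Require Import functions.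
From HB Require Import structures.

Set Implicit Arguments.
Unset Strict Implicit.
Unset Printing Implicit Defensive.

Import Order.TTheory GRing.Theory Num.Theory.
Import numFieldNormedType.Exports.

Local Open Scope classical_set_scope.
Local Open Scope ring_scope.

(** Each coordinate x_k (Mx)_k - 1 is a product of two linear forms up to a
constant, so by the Leibniz rule the differential of the map at a sends h to
(h_k (Ma)_k + a_k (Mh)_k)_k: in the row-vector convention the Jacobian matrix is
J = D(Ma) + M^T D(a).  At an inverse eigenvector a one has a_k (Ma)_k = 1, i.e.
D(a) D(Ma) = I, hence D(a) J = I + D(a) M^T D(a) = (I + D(a) M D(a))^T
([scaled_jacobian]).  The same relation makes D(a) invertible, so det J and
det (I + D(a) M D(a)) vanish together, and the latter vanishes exactly when -1
is an eigenvalue of D(a) M D(a). *)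

Section DiffSum.
Context {K : numFieldType} {V : normedModType K}.

Lemma is_diff_sum {W : normedModType K} (I : Type) (r : seq I)
    (f df : I -> V -> W) (x : V) :
  (forall i, is_diff x (f i) (df i)) ->
  is_diff x (\sum_(i <- r) f i) (\sum_(i <- r) df i).
Proof.
move=> fdf; elim/big_ind2: _ => [|f1 df1 f2 df2 ? ?|i _]; last exact: fdf.
- exact: is_diff_cst.
- exact: is_diffD.
Qed.

(** A row of functions is a sum of scalar functions times basis vectors, so only
the differentials of sums and of scalings are involved, and no estimate on the
norm of rows is needed. *)
Lemma is_diff_row n (g dg : 'I_n -> V -> K) (x : V) :
  (forall k, is_diff x (g k) (dg k)) ->
  is_diff x (fun y => \row_k g k y) (fun y => \row_k dg k y).
Proof.
move=> gdg.
have rowE (h : 'I_n -> V -> K) : (fun y => \row_k h k y) =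
    \sum_(k < n) (fun y => h k y *: (delta_mx 0 k : 'rV[K]_n)).
  apply/funext => y; rewrite [LHS]row_sum_delta fct_sumE.
  by apply: eq_bigr => k _; rewrite mxE.
rewrite !rowE; apply: is_diff_sum => k.
have gk := @ex_diff _ _ _ _ _ _ _ (gdg k).
by split; [exact: differentiableZl|rewrite diffZl // diff_val].
Qed.

End DiffSum.

Section Jacobian.
Context {K : numFieldType}.

Lemma is_diff_coord n (a : 'rV[K]_n) (k : 'I_n) :
  is_diff a (fun x : 'rV[K]_n => x 0 k : K) (fun x => x 0 k).
Proof.
have lin : linear (fun x : 'rV[K]_n => x 0 k : K) by move=> c u v; rewrite !mxE.
pose f : {linear 'rV[K]_n -> K} := HB.pack (fun x : 'rV[K]_n => x 0 k : K)
  (GRing.isLinear.Build K 'rV[K]_n K *:%R _ lin).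
have fc : continuous f by exact: coord_continuous.
by split; [exact: differentiable_coord|exact: (diff_lin a fc)].
Qed.

Lemma is_diff_mulmx_coord n (M : 'M[K]_n) (a : 'rV[K]_n) (k : 'I_n) :
  is_diff a (fun x : 'rV[K]_n => (M *m x^T) k 0 : K)
            (fun x => (M *m x^T) k 0).
Proof.
have -> : (fun x : 'rV[K]_n => (M *m x^T) k 0 : K) =
    \sum_(j < n) (M k j *: ((fun x => x 0 j) : 'rV[K]_n -> K)).
  by apply/funext => x; rewrite fct_sumE mxE; apply: eq_bigr => j _; rewrite mxE.
by apply: is_diff_sum => j; apply: is_diffZ; exact: is_diff_coord.
Qed.

Lemma jacobian_inv_eigen_map n (M : 'M[K]_n) (a : 'rV[K]_n) :
  'J (inv_eigen_map M) a = diag_mx (M *m a^T)^T + M^T *m diag_mx a.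
Proof.
pose g (k : 'I_n) : 'rV[K]_n -> K :=
  ((fun x => x 0 k) : 'rV[K]_n -> K) * (fun x => (M *m x^T) k 0) - cst 1.
pose dg (k : 'I_n) : 'rV[K]_n -> K :=
  a 0 k *: ((fun x => (M *m x^T) k 0) : 'rV[K]_n -> K)
    + (M *m a^T) k 0 *: ((fun x => x 0 k) : 'rV[K]_n -> K) - 0.
have gdg k : is_diff a (g k) (dg k).
  apply: is_diffB; apply: is_diffM.
  - exact: is_diff_coord.
  - exact: is_diff_mulmx_coord.
have fdf : is_diff a (inv_eigen_map M) (fun x => \row_k dg k x).
  exact: (is_diff_row gdg).
rewrite /jacobian diff_val; apply/matrixP => i j.
have dgE : dg j (delta_mx 0 i) =
    a 0 j * M j i + (M *m a^T) j 0 * (i == j)%:R.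
  rewrite /dg subr0; congr (_ * _ + _ * _); last by rewrite mxE eqxx eq_sym.
  by rewrite trmx_delta -colE mxE.
rewrite mul_mx_diag !mxE dgE mulrC addrC mulr_natr; congr (_ + _).
by case: eqP => [->|//]; rewrite !mxE.
Qed.

(** The defining equations a_k (Ma)_k = 1 turn D(a) D(Ma) into the
identity; D(a) M^T D(a) is left over, whence the transpose. *)
Lemma scaled_jacobian n (M : 'M[K]_n) (a : 'rV[K]_n) :
  inv_eigenvectors M a ->
  diag_mx a *m 'J (inv_eigen_map M) a =
    (1%:M + diag_mx a *m M *m diag_mx a)^T.
Proof.
move=> Ia; have aMa k : a 0 k * (M *m a^T) k 0 = 1.
  by move/rowP/(_ k): Ia; rewrite !mxE => /eqP; rewrite subr_eq0 => /eqP.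
rewrite jacobian_inv_eigen_map mulmxDr !raddfD /= trmx1 !trmx_mul tr_diag_mx.
congr (_ + _); rewrite mulmx_diag -diag_const_mx; congr (diag_mx _).
by apply/rowP => k; rewrite -trmx_mul !mxE -(aMa k) !mxE.
Qed.

Lemma inv_eigenvector_det_diag_neq0 n (M : 'M[K]_n) (a : 'rV[K]_n) :
  inv_eigenvectors M a -> \det (diag_mx a) != 0.
Proof.
move=> Ia; rewrite det_diag; apply/prodf_neq0 => k _; apply/eqP => ak0.
move/rowP/(_ k): Ia; rewrite mxE ak0 mul0r sub0r mxE => /eqP.
by rewrite oppr_eq0 oner_eq0.
Qed.

Lemma det_jacobian_neq0 n (M : 'M[K]_n) (a : 'rV[K]_n) :
  inv_eigenvectors M a ->
  (\det ('J (inv_eigen_map M) a) != 0) =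
  (\det (1%:M + diag_mx a *m M *m diag_mx a) != 0).
Proof.
move=> Ia; rewrite -[in RHS]det_tr -(scaled_jacobian Ia) det_mulmx mulf_eq0.
by rewrite (negPf (inv_eigenvector_det_diag_neq0 Ia)).
Qed.

End Jacobian.

Lemma det_add1_neq0 (F : fieldType) n (A : 'M[F]_n) :
  \det (1%:M + A) != 0 <-> ~ spectrum A (-1).
Proof.
have -> : 1%:M + A = A - (-1)%:M by rewrite raddfN /= opprK addrC.
rewrite /spectrum /= /eigenvalue /eigenspace kermx_eq0 row_free_unit unitmxE.
by rewrite unitfE; split => [->//|/negP]; rewrite negbK.
Qed.

Theorem proposition1 (R : realType) (n : nat) (hn : (2 <= n)%N)
    (M : 'M[R[i]]_n) :
  (transverse M <->
     forall a : 'rV[R[i]]_n, inv_eigenvectors M a ->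
       \det (1%:M + diag_mx a *m M *m diag_mx a) != 0)
  /\
  (transverse M <->
     forall a : 'rV[R[i]]_n, inv_eigenvectors M a ->
       ~ spectrum (diag_mx a *m M *m diag_mx a) (-1)).
Proof.
have iff_det : transverse M <-> forall a : 'rV[R[i]]_n, inv_eigenvectors M a ->
    \det (1%:M + diag_mx a *m M *m diag_mx a) != 0.
  by split=> h a Ia; move: (h a Ia); rewrite det_jacobian_neq0.
split; first exact: iff_det.
split=> [/iff_det h a Ia|h]; first by apply/det_add1_neq0; exact: h.
by apply/iff_det => a Ia; apply/det_add1_neq0; exact: h.
Qed.
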